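(* Let $n\ge 2$, let $\Omega\subset\mathbb{H}^n$ be an unbounded open set and let $u$ be an eigenfunction associated to some $\lambda\in(0,\lambda_1]$ in $\Omega$, where $\lambda_1=\frac{(n-1)^2}{4}$. If $u$ can be extended continuously to $\partial_\infty\Omega$ (i.e. $u$ extends to a continuous real-valued function on $\overline{\Omega}\cup\partial_\infty\Omega$ with the cone topology), then $\lim_{x\to\infty}u(x)=0$, i.e. $u(x)\to 0$ as $x\in\Omega$ leaves every bounded subset of $\mathbb{H}^n$.
   Context: $\Delta$ is the Laplace–Beltrami operator of $\mathbb{H}^n$ (curvature $-1$), and $\lambda_1=\lambda_1(\mathbb{H}^n)=\frac{(n-1)^2}{4}$. For an open set $\Omega\subset\mathbb{H}^n$ and $\lambda\in\mathbb{R}$, an eigenfunction associated to $\lambda$ in $\Omega$ is a function $u\in C(\overline{\Omega})\cap C^2(\Omega)$, not identically zero, with $-\Delta u=\lambda u$ in $\Omega$ and $u=0$ on $\partial\Omega$ (closure and boundary taken in $\mathbb{H}^n$). The compactification $\mathbb{H}^n\cup\partial_\infty\mathbb{H}^n$ carries the cone topology, and for $A\subset\mathbb{H}^n$ the asymptotic boundary $\partial_\infty A$ is the intersection of $\partial_\infty\mathbb{H}^n$ with the closure of $A$ in this compactification. *)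

(* Defs.v *)
From HB Require Import structures.
From mathcomp Require Import all_boot all_order all_algebra.
From mathcomp Require Import all_classical all_reals all_analysis.

Set Implicit Arguments.
Unset Strict Implicit.
Unset Printing Implicit Defensive.

Import Order.TTheory GRing.Theory Num.Theory.
Import numFieldNormedType.Exports.

Local Open Scope classical_set_scope.
Local Open Scope ring_scope.

(* Hyperbolic space H^n is taken in the Poincaré ball model: the open Euclidean
   unit ball of R^n with the metric 4 |dx|^2 / (1 - |x|^2)^2, of constant
   curvature -1. The library norm on 'rV[R]_n is the sup norm, so the Euclidean
   norm is defined here; both induce the same topology on R^n, which restricts
   to the manifold topology on the ball. *)

Definition edot {R : realType} {n : nat} (x y : 'rV[R]_n) : R :=
  \sum_(i < n) x ord0 i * y ord0 i.

Definition enorm {R : realType} {n : nat} (x : 'rV[R]_n) : R :=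
  Num.sqrt (edot x x).

Definition hspace (R : realType) (n : nat) : set 'rV[R]_n :=
  [set x | enorm x < 1].
Arguments hspace : clear implicits.

(* The matrix (g_ij) of the metric at x, in the coordinates of the ball. *)
Definition hmetric {R : realType} {n : nat} (x : 'rV[R]_n) : 'M[R]_n :=
  ((2 / (1 - enorm x ^+ 2)) ^+ 2)%:M.

Definition arcosh {R : realType} (t : R) : R := ln (t + Num.sqrt (t ^+ 2 - 1)).

(* Riemannian distance of hmetric. *)
Definition hdist {R : realType} {n : nat} (x y : 'rV[R]_n) : R :=
  arcosh (1 + 2 * enorm (x - y) ^+ 2
              / ((1 - enorm x ^+ 2) * (1 - enorm y ^+ 2))).

Definition hbounded {R : realType} {n : nat} (A : set 'rV[R]_n) : Prop :=
  A `<=` hspace R n /\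
  exists p : 'rV[R]_n, exists r : R,
    hspace R n p /\ A `<=` [set x | hdist p x <= r].

(* The filter of complements of bounded subsets of H^n. *)
Definition hinfty (R : realType) (n : nat) : set_system 'rV[R]_n :=
  filter_from [set K | hbounded K] (fun K => hspace R n `\` K).
Arguments hinfty : clear implicits.

Definition hclosure {R : realType} {n : nat} (A : set 'rV[R]_n) :
    set 'rV[R]_n :=
  closure A `&` hspace R n.

Definition hboundary {R : realType} {n : nat} (A : set 'rV[R]_n) :
    set 'rV[R]_n :=
  hclosure A `\` interior A.

Definition partial {R : realType} {n : nat} (i : 'I_n) (f : 'rV[R]_n -> R)
    (x : 'rV[R]_n) : R :=
  'D_(delta_mx ord0 i) f x.

(* For open A: all partial derivatives of order 1 and 2 exist and are
   continuous in A. *)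
Definition C2_on {R : realType} {n : nat} (A : set 'rV[R]_n)
    (f : 'rV[R]_n -> R) : Prop :=
  forall x, A x -> forall i j : 'I_n,
    [/\ derivable f x (delta_mx ord0 i),
        {for x, continuous (partial i f)},
        derivable (partial i f) x (delta_mx ord0 j) &
        {for x, continuous (partial j (partial i f))}].

(* Laplace-Beltrami operator of a metric g in global coordinates:
   |g|^(-1/2) \sum_i d_i (|g|^(1/2) \sum_j g^ij d_j f). *)
Definition laplace_beltrami {R : realType} {n : nat}
    (g : 'rV[R]_n -> 'M[R]_n) (f : 'rV[R]_n -> R) (x : 'rV[R]_n) : R :=
  (Num.sqrt (\det (g x)))^-1 *
  \sum_(i < n) partial i
    (fun y => Num.sqrt (\det (g y)) *
              \sum_(j < n) (invmx (g y)) i j * partial j f y) x.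

Definition hlaplacian {R : realType} {n : nat} (f : 'rV[R]_n -> R) :
    'rV[R]_n -> R :=
  laplace_beltrami hmetric f.

(* u is a total function on R^n; only its values on hclosure Omega matter. *)
Definition eigenfunction {R : realType} {n : nat} (Omega : set 'rV[R]_n)
    (lambda : R) (u : 'rV[R]_n -> R) : Prop :=
  [/\ {within hclosure Omega, continuous u},
      C2_on Omega u,
      exists2 x, hclosure Omega x & u x != 0,
      forall x, Omega x -> - hlaplacian u x = lambda * u x &
      forall x, hboundary Omega x -> u x = 0].

(* Geodesic rays issuing from the centre 0 of the ball are Euclidean radii, and
   every class of asymptotic rays contains exactly one of them; so the boundary
   at infinity of H^n is identified with the Euclidean unit sphere. Angles at 0
   between rays are Euclidean angles, the metric being conformal. *)

Definition hsphere (R : realType) (n : nat) : set 'rV[R]_n :=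
  [set x | enorm x = 1].
Arguments hsphere : clear implicits.

Definition hcompact (R : realType) (n : nat) : set 'rV[R]_n :=
  hspace R n `|` hsphere R n.
Arguments hcompact : clear implicits.

Definition angle0 {R : realType} {n : nat} (x y : 'rV[R]_n) : R :=
  acos (edot x y / (enorm x * enorm y)).

Definition truncated_cone {R : realType} {n : nat} (xi : 'rV[R]_n)
    (theta r : R) : set 'rV[R]_n :=
  [set x | [/\ hcompact R n x, angle0 x xi < theta &
               hspace R n x -> r < hdist 0 x]].

(* Neighbourhoods in the cone topology of hcompact: a point of H^n keeps its
   usual neighbourhoods, and a point at infinity has the truncated cones about
   it as a base of neighbourhoods. *)
Definition cone_nbhs {R : realType} {n : nat} (x : 'rV[R]_n) :
    set_system 'rV[R]_n :=
  if enorm x < 1 then nbhs x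
  else filter_from [set p : R * R | 0 < p.1 /\ 0 < p.2]
                   (fun p => truncated_cone x p.1 p.2).

Definition cone_closure {R : realType} {n : nat} (A : set 'rV[R]_n) :
    set 'rV[R]_n :=
  [set x | hcompact R n x /\ forall B, cone_nbhs x B -> A `&` B !=set0].

Definition asymptotic_boundary {R : realType} {n : nat} (A : set 'rV[R]_n) :
    set 'rV[R]_n :=
  hsphere R n `&` cone_closure A.

Definition cone_continuous_on {R : realType} {n : nat} (D : set 'rV[R]_n)
    (f : 'rV[R]_n -> R) : Prop :=
  forall x, D x -> f @ within D (cone_nbhs x) --> f x.

Definition extends_to_infinity {R : realType} {n : nat} (Omega : set 'rV[R]_n)
    (u : 'rV[R]_n -> R) : Prop :=
  exists U : 'rV[R]_n -> R,
    (forall x, hclosure Omega x -> U x = u x) /\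
    cone_continuous_on (hclosure Omega `|` asymptotic_boundary Omega) U.

(* Main.v *)
Require Import Defs.
From mathcomp Require Import all_boot all_order all_algebra.
From mathcomp Require Import all_classical all_reals all_analysis.
From mathcomp Require Import ring lra.
Import Order.TTheory GRing.Theory Num.Theory.
Import numFieldNormedType.Exports.
Local Open Scope classical_set_scope.
Local Open Scope ring_scope.

(** The proof tests u against a quadratic barrier near a point at infinity.

    Suppose u does not tend to 0.  By compactness of the closed Euclidean ball,
    points of Omega leaving every bounded set, at which |u| stays above a fixed
    e > 0, accumulate at a point xi of the unit sphere.  This xi lies in the
    asymptotic boundary, and the intersection of a Euclidean neighbourhood of xi
    with the closed ball is contained in any prescribed truncated cone about xi
    (lemma [truncated_cone_near]); hence u has at xi the limit c = U(xi) along
    the closure of Omega, and |c| >= e.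

    On the other hand c must vanish (lemma [boundary_value_eq0]).  A Euclidean
    ball centred at x and of radius half the distance of x to the sphere has
    bounded hyperbolic size, however close x is to xi.  So the function
    phi(y) = |y - x|^2, normalised to be of order 1 on the boundary of that
    ball, has a hyperbolic Laplacian bounded by a constant depending on n only.
    If c u stays within e of c^2 on the ball, then c u + 2 e phi has a minimum
    inside; there the Laplacian of c u is at least - C e, and the equation
    - Delta u = lambda u gives lambda (c^2 - e) <= C e (lemma
    [eigenfunction_oscillation], with C = 48 n).  As x tends to xi, e can be
    taken arbitrarily small, so c^2 = 0.  The minimum is not on the boundary of
    Omega, because c u is positive at it and zero on that boundary; hence the
    equation does hold there. *)

(** * Euclidean inner product and norm *)

Lemma edotC {R : realType} {n : nat} (x y : 'rV[R]_n) : edot x y = edot y x.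
Proof. by apply: eq_bigr => i _; rewrite mulrC. Qed.

Lemma edotDl {R : realType} {n : nat} (x y z : 'rV[R]_n) :
  edot (x + y) z = edot x z + edot y z.
Proof. by rewrite -big_split; apply: eq_bigr => i _; rewrite mxE mulrDl. Qed.

Lemma edotZl {R : realType} {n : nat} (a : R) (x z : 'rV[R]_n) :
  edot (a *: x) z = a * edot x z.
Proof. by rewrite mulr_sumr; apply: eq_bigr => i _; rewrite mxE mulrA. Qed.

Lemma edotDr {R : realType} {n : nat} (x y z : 'rV[R]_n) :
  edot z (x + y) = edot z x + edot z y.
Proof. by rewrite !(edotC z) edotDl. Qed.

Lemma edotZr {R : realType} {n : nat} (a : R) (x z : 'rV[R]_n) :
  edot z (a *: x) = a * edot z x.
Proof. by rewrite !(edotC z) edotZl. Qed.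

Lemma edotNr {R : realType} {n : nat} (x z : 'rV[R]_n) :
  edot z (- x) = - edot z x.
Proof. by rewrite -scaleN1r edotZr mulN1r. Qed.

Lemma edotNl {R : realType} {n : nat} (x z : 'rV[R]_n) :
  edot (- x) z = - edot x z.
Proof. by rewrite edotC edotNr edotC. Qed.

Lemma edot_delta {R : realType} {n : nat} (i : 'I_n) (x : 'rV[R]_n) :
  edot (delta_mx ord0 i) x = x ord0 i.
Proof.
rewrite /edot (bigD1 i) //= mxE !eqxx mul1r big1 ?addr0 // => j ji.
by rewrite mxE (negbTE ji) andbF mul0r.
Qed.

Lemma edot_ge0 {R : realType} {n : nat} (x : 'rV[R]_n) : 0 <= edot x x.
Proof. by apply: sumr_ge0 => i _; rewrite -expr2 sqr_ge0. Qed.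

Lemma enorm_ge0 {R : realType} {n : nat} (x : 'rV[R]_n) : 0 <= enorm x.
Proof. exact: sqrtr_ge0. Qed.

Lemma sqr_enorm {R : realType} {n : nat} (x : 'rV[R]_n) :
  enorm x ^+ 2 = edot x x.
Proof. by rewrite sqr_sqrtr // edot_ge0. Qed.

Lemma normr_coord_le_enorm {R : realType} {n : nat} (x : 'rV[R]_n) i :
  `|x ord0 i| <= enorm x.
Proof.
rewrite -sqrtr_sqr; apply: ler_wsqrtr.
rewrite expr2 /edot (bigD1 i) //= lerDl.
by apply: sumr_ge0 => j _; rewrite -expr2 sqr_ge0.
Qed.

(** Compares the sup norm, which gives the topology, with the Euclidean norm,
    which gives the geometry. *)
Lemma norm_le_enorm {R : realType} {n : nat} (x : 'rV[R]_n) : `|x| <= enorm x.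
Proof.
rewrite [leLHS]mx_normrE; apply: bigmax_le => [|[j i] _]; first exact: enorm_ge0.
by rewrite /= (ord1 j) normr_coord_le_enorm.
Qed.

Lemma enorm0 {R : realType} {n : nat} : enorm (0 : 'rV[R]_n) = 0.
Proof. by rewrite /enorm -(scale0r 0) edotZl mul0r sqrtr0. Qed.

Lemma enorm_eq0 {R : realType} {n : nat} (x : 'rV[R]_n) : enorm x = 0 -> x = 0.
Proof.
by move=> x0; move: (norm_le_enorm x); rewrite x0 normr_le0 => /eqP.
Qed.

(** Cauchy-Schwarz: expand the square of |y| x - |x| y. *)
Lemma edot_le_enorm {R : realType} {n : nat} (x y : 'rV[R]_n) :
  edot x y <= enorm x * enorm y.
Proof.
have [/enorm_eq0 ->|x0] := eqVneq (enorm x) 0.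
  by rewrite -(scale0r 0) edotZl mul0r mulr_ge0 // enorm_ge0.
have [/enorm_eq0 ->|y0] := eqVneq (enorm y) 0.
  by rewrite -(scale0r 0) edotZr mul0r mulr_ge0 // enorm_ge0.
have xgt : 0 < enorm x by rewrite lt_def x0 enorm_ge0.
have ygt : 0 < enorm y by rewrite lt_def y0 enorm_ge0.
have := edot_ge0 (enorm y *: x - enorm x *: y).
rewrite !(edotDl, edotDr, edotZl, edotZr, edotNl, edotNr).
rewrite (edotC y x) -!sqr_enorm => H.
rewrite -(ler_pM2l (mulr_gt0 xgt ygt)).
by nra.
Qed.

Lemma enorm_triangle {R : realType} {n : nat} (x y : 'rV[R]_n) :
  enorm (x + y) <= enorm x + enorm y.
Proof.
have h := edot_le_enorm x y.
rewrite -(@ler_pXn2r _ 2) ?nnegrE ?addr_ge0 ?enorm_ge0 //.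
rewrite sqr_enorm !(edotDl, edotDr) (edotC y x) -!sqr_enorm.
by nra.
Qed.

Lemma enormN {R : realType} {n : nat} (x : 'rV[R]_n) : enorm (- x) = enorm x.
Proof. by rewrite /enorm edotNr edotNl opprK. Qed.

Lemma continuous_edot {R : realType} {n : nat} (f g : 'rV[R]_n -> 'rV[R]_n) :
  continuous f -> continuous g -> continuous (fun x => edot (f x) (g x)).
Proof.
move=> cf cg; apply: continuous_big => [|i _ x]; first exact: add_continuous.
apply: cvgM; first exact: (nbhs_filter x).
  exact: (continuous_comp (cf x) (@coord_continuous R 1 n ord0 i (f x))).
exact: (continuous_comp (cg x) (@coord_continuous R 1 n ord0 i (g x))).
Qed.

Lemma continuous_enorm {R : realType} {n : nat} : continuous (@enorm R n).
Proof.
move=> x; apply: (cvg_comp (fun y => edot y y) Num.sqrt).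
  by apply: continuous_edot => y; exact: cvg_id.
exact: sqrt_continuous.
Qed.

Lemma continuous_enormB {R : realType} {n : nat} (x : 'rV[R]_n) :
  continuous (fun y : 'rV[R]_n => enorm (y - x)).
Proof.
move=> y; apply: (@continuous_comp 'rV[R]_n 'rV[R]_n R (fun y : 'rV[R]_n => y - x) enorm).
  exact: (cvgB cvg_id (cvg_cst x)).
exact: continuous_enorm.
Qed.

Lemma enorm_le_compact {R : realType} {n : nat} (x : 'rV[R]_n) (r : R) :
  compact [set y | enorm (y - x) <= r].
Proof.
apply: bounded_closed_compact.
  exists (enorm x + r); split; first exact: num_real.
  move=> M rM y /= yr; apply: le_trans (norm_le_enorm y) _.
  apply: le_trans (ltW rM); rewrite -{1}(subrK x y) addrC.
  by apply: le_trans (enorm_triangle _ _) _; rewrite lerD2l.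
have -> : [set y | enorm (y - x) <= r]
        = (fun y : 'rV[R]_n => enorm (y - x)) @^-1` [set z | z <= r] by [].
apply: preimage_closed; last exact: closed_le.
by move=> y _; exact: continuous_enormB.
Qed.

Lemma enorm_near {R : realType} {n : nat} (x : 'rV[R]_n) (e : R) :
  0 < e -> \forall y \near x, enorm (y - x) < e.
Proof.
move=> e0; apply: (cvgr_lt _ (continuous_enormB x x)).
by rewrite subrr enorm0.
Qed.

(** * Derivatives along lines and second-order conditions *)

(** Turns directional derivatives in several variables into one-variable
    derivatives, at every parameter of the line and not only at the origin, so
    that it can be iterated. *)
Lemma is_derive_line {R : realType} {n : nat} (f : 'rV[R]_n -> R)
    (y v : 'rV[R]_n) (t : R) :
  derivable f (t *: v + y) v ->
  is_derive t (1 : R) (fun h => f (h *: v + y)) ('D_v f (t *: v + y)).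
Proof.
have E : (fun h : R => h^-1 *: (((fun k => f (k *: v + y)) \o shift t) (h *: 1)
            - f (t *: v + y)))
       = (fun h => h^-1 *: ((f \o shift (t *: v + y)) (h *: v)
            - f (t *: v + y))).
  by apply/funext => h /=; rewrite [h *: 1]mulr1 scalerDl addrA.
by move=> fD; split; rewrite /derivable /derive E.
Qed.

Lemma is_derive_line0 {R : realType} {n : nat} (f : 'rV[R]_n -> R)
    (y v : 'rV[R]_n) :
  derivable f y v ->
  is_derive (0 : R) (1 : R) (fun h => f (h *: v + y)) ('D_v f y).
Proof.
move=> fD; have yE : (0 : R) *: v + y = y by rewrite scale0r add0r.
by rewrite -{2}yE; apply: is_derive_line; rewrite yE.
Qed.

Lemma is_derive_quadratic {R : realType} (a b c t : R) :
  is_derive t (1 : R) (fun x : R => a + b * x + c * x ^+ 2) (b + 2 * c * t).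
Proof.
have -> : (fun x : R => a + b * x + c * x ^+ 2)
        = cst a + b \*: id + c \*: (id ^+ 2) by [].
apply: is_derive_eq.
transitivity (0 + b * 1 + c * ((2 * t ^+ 1) * 1)); first by [].
by ring.
Qed.

(** If the second derivative were negative, the first one, which vanishes at
    the minimum, would be negative just to the right of it, and the mean value
    theorem would make k smaller there than at the minimum. *)
Lemma local_min_derivatives {R : realType} (k k1 : R -> R) (k2 : R) :
  (\forall t \near (0 : R), is_derive (t : R) (1 : R) k (k1 t)) ->
  is_derive (0 : R) (1 : R) k1 k2 ->
  (\forall t \near (0 : R), k 0 <= k t) ->
  k1 0 = 0 /\ 0 <= k2.
Proof.
move=> dk dk1 kmin.
have /nbhs_ballP[d /= d0 hd] : \forall t \near (0 : R),
  is_derive (t : R) (1 : R) k (k1 t) /\ k 0 <= k t by near=> t; split; near: t.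
have inI t : t \in `]-d, d[ -> is_derive (t : R) (1 : R) k (k1 t) /\ k 0 <= k t.
  rewrite in_itv /= => td; apply: hd.
  by rewrite /ball /= sub0r normrN ltr_norml.
have k10 : k1 0 = 0.
  have D0 : is_derive (0 : R) (1 : R) k 0.
    apply: (@derive1_at_min _ k (-d) d 0).
    - by move: d0; lra.
    - by move=> t /inI[[]].
    - by rewrite in_itv /= oppr_lt0 d0.
    - by move=> t /inI[].
  have [|D1 _] := inI 0; first by rewrite in_itv /= oppr_lt0 d0.
  by rewrite -(@derive_val _ _ _ _ _ _ _ D1) (@derive_val _ _ _ _ _ _ _ D0).
split => //; rewrite leNgt; apply/negP => k2lt0.
have cv : (fun h : R => h^-1 * k1 h) @ 0^' --> k2.
  have [dd e] := dk1; rewrite -e; move: dd; rewrite /derivable /derive.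
  have -> : (fun h : R => h^-1 *: ((k1 \o shift 0) (h *: 1) - k1 0))
    = (fun h => h^-1 * k1 h) by apply/funext => h /=; rewrite k10 subr0 addr0 [h *: 1]mulr1.
  by [].
have : \forall h \near (0 : R)^', h^-1 * k1 h < 0.
  by apply: (cvgr_lt k2).
rewrite near_withinE => /nbhs_ballP[e /= e0 he].
pose t := Num.min d e / 2.
have t0 : 0 < t by rewrite divr_gt0 // lt_min d0.
have m0 : 0 < Num.min d e by rewrite lt_min d0.
have tm : t < Num.min d e by rewrite /t; lra.
have td : t < d by rewrite (lt_le_trans tm) // ge_min lexx.
have te : t < e by rewrite (lt_le_trans tm) // ge_min lexx orbT.
have dI s : 0 <= s <= t -> s \in `]-d, d[.
  by move=> /andP[s0 st]; rewrite in_itv /= (lt_le_trans _ s0) ?oppr_lt0 //= (le_lt_trans st).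
have [||s] := @MVT R k k1 0 t t0.
- move=> s; rewrite in_itv /= => /andP[s0 st].
  by have [|] := inI s; first by apply: dI; rewrite !ltW.
- apply: derivable_within_continuous => s; rewrite in_itv /= => /dI /inI[[]] //.
rewrite in_itv /= => /andP[s0 st] E.
have k1s : k1 s < 0.
  have := he s _ _; rewrite /ball /= sub0r normrN gtr0_norm // (lt_trans st te) gt_eqF //.
  by move=> /(_ isT isT); rewrite pmulr_rlt0 ?invr_gt0.
have [_] : is_derive (t : R) (1 : R) k (k1 t) /\ k 0 <= k t.
  by apply: inI; apply: dI; rewrite lexx ltW.
by rewrite -subr_ge0 E subr0 pmulr_lge0 // leNgt k1s.
Unshelve. all: by end_near.
Qed.

(** Along the line through y in direction i the quadratic b |. - x|^2 is a
    polynomial of degree 2 with first derivative 2 b (y - x)_i and second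
    derivative 2 b, so these are the conditions of [local_min_derivatives] with
    the barrier moved to the other side. *)
Lemma local_min_partials {R : realType} {n : nat} (u : 'rV[R]_n -> R)
    (s b : R) (x y : 'rV[R]_n) (i : 'I_n) :
  (\forall z \near y, derivable u z (delta_mx ord0 i)) ->
  derivable (partial i u) y (delta_mx ord0 i) ->
  (\forall z \near y, s * u y + b * edot (y - x) (y - x)
                   <= s * u z + b * edot (z - x) (z - x)) ->
  s * partial i u y = - (2 * b * (y - x) ord0 i) /\
  - (2 * b) <= s * partial i (partial i u) y.
Proof.
move=> du ddu umin; pose v : 'rV[R]_n := delta_mx ord0 i.
have lineP (P : set 'rV[R]_n) : (\forall z \near y, P z) ->
    \forall t \near (0 : R), P (t *: v + y).
  have cl : continuous (fun t : R => t *: v + y).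
    by move=> t; apply: cvgD; [exact: scalel_continuous | exact: cvg_cst].
  by move=> Py; apply: (cl 0 P); rewrite scale0r add0r.
pose w : R := (y - x) ord0 i.
have vvE : edot v v = 1 by rewrite edot_delta mxE !eqxx.
have edE t : edot (t *: v + y - x) (t *: v + y - x)
           = edot (y - x) (y - x) + 2 * w * t + t ^+ 2.
  rewrite -addrA /w; move: (y - x) => p.
  rewrite !(edotDl, edotDr, edotZl, edotZr) (edotC p v) vvE edot_delta.
  ring.
pose k := (s \*: (fun t : R => u (t *: v + y)))
  + (fun t : R => b * edot (y - x) (y - x) + 2 * b * w * t + b * t ^+ 2).
have kE t : k t = s * u (t *: v + y)
     + b * edot (t *: v + y - x) (t *: v + y - x).
  rewrite edE; transitivity (s * u (t *: v + y)
    + (b * edot (y - x) (y - x) + 2 * b * w * t + b * t ^+ 2)); first by [].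
  by ring.
pose k1 := (s \*: (fun t : R => partial i u (t *: v + y)))
  + (fun t : R => 2 * b * w + 2 * b * t + 0 * t ^+ 2).
have [|||k10 k2] := @local_min_derivatives R k k1
    (s * partial i (partial i u) y + (2 * b + 2 * 0 * 0)).
- apply: filterS (lineP _ du) => t dt.
  have -> : k1 t = s *: partial i u (t *: v + y) + (2 * b * w + 2 * b * t).
    by rewrite /k1 !fctE mul0r addr0.
  exact: (is_deriveD (is_deriveZ s (is_derive_line _ _ _ _ dt))
                     (is_derive_quadratic _ _ _ t)).
- exact: (is_deriveD (is_deriveZ s (is_derive_line0 _ _ _ ddu))
                     (is_derive_quadratic _ _ 0 0)).
- apply: filterS (lineP _ umin) => t.
  by rewrite !kE scale0r add0r.
have k1E : k1 0 = s * partial i u y + 2 * b * w.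
  transitivity (s * partial i u (0 *: v + y)
    + (2 * b * w + 2 * b * 0 + 0 * 0 ^+ 2)); first by [].
  by rewrite scale0r add0r mulr0 mul0r !addr0.
by rewrite -/w; split; lra.
Qed.

(** * The hyperbolic Laplacian in the ball *)

Lemma is_derive_edot {R : realType} {n : nat} (y v : 'rV[R]_n) :
  is_derive y v (fun x => edot x x) (2 * edot v y).
Proof.
have E : (fun h : R => edot (h *: v + y) (h *: v + y))
       = (fun h : R => edot y y + (2 * edot v y) * h + edot v v * h ^+ 2).
  apply/funext => h; rewrite !(edotDl, edotDr, edotZl, edotZr) (edotC y v).
  by ring.
have D0 : is_derive (0 : R) (1 : R)
    (fun h : R => edot (h *: v + y) (h *: v + y)) (2 * edot v y).
  rewrite E; have := is_derive_quadratic (edot y y) (2 * edot v y) (edot v v) 0.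
  by rewrite mulr0 addr0.
have fD : derivable (fun x => edot x x) y v.
  by apply/derivable1P; exact: (@ex_derive _ _ _ _ _ _ _ D0).
split=> //.
have D1 : is_derive (0 : R) (1 : R) (fun h : R => edot (h *: v + y) (h *: v + y))
    ('D_v (fun x => edot x x) y) by exact: (is_derive_line0 _ _ _ fD).
by rewrite -(@derive_val _ _ _ _ _ _ _ D1) (@derive_val _ _ _ _ _ _ _ D0).
Qed.

Lemma hmetricE {R : realType} {n : nat} (y : 'rV[R]_n) :
  hmetric y = ((2 / (1 - edot y y)) ^+ 2)%:M.
Proof. by rewrite /hmetric sqr_enorm. Qed.

(** With rho = 2 / (1 - |y|^2) the metric is rho^2 times the Euclidean one, so
    sqrt |g| g^ij is rho^(n-2) times the identity, and the formula is the
    product rule applied to rho^(n-2) d_i u with d_i rho = rho^2 y_i.  The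
    assumption 2 <= n makes rho^(n-2) a power with natural exponent. *)
Lemma hlaplacianE {R : realType} {n : nat} (u : 'rV[R]_n -> R) (y : 'rV[R]_n) :
  (2 <= n)%N -> hspace R n y ->
  (forall i, derivable (partial i u) y (delta_mx ord0 i)) ->
  hlaplacian u y =
  ((1 - edot y y) / 2) ^+ 2 * (\sum_(i < n) partial i (partial i u) y)
  + (n%:R - 2) * ((1 - edot y y) / 2) * \sum_(i < n) y ord0 i * partial i u y.
Proof.
case: n u y => [|[|m]] // u y _ yH du.
have y1 : edot y y < 1.
  by rewrite -sqr_enorm expr_lt1 ?enorm_ge0.
pose rho (z : 'rV[R]_m.+2) : R := 2 / (1 - edot z z).
have detE z : edot z z < 1 -> Num.sqrt (\det (hmetric z)) = rho z ^+ m.+2.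
  move=> z1; rewrite hmetricE det_scalar -/(rho z) exprAC sqrtr_sqr ger0_norm //.
  by rewrite exprn_ge0 // divr_ge0 // subr_ge0 ltW.
have fluxE i : partial i (fun z => Num.sqrt (\det (hmetric z)) *
     \sum_(j < m.+2) (invmx (hmetric z)) i j * partial j u z) y
   = partial i (fun z => rho z ^+ m * partial i u z) y.
  apply: near_eq_derive.
  have : \forall z \near y, edot z z < 1.
    have ce : continuous (fun z : 'rV[R]_m.+2 => edot z z).
      by apply: continuous_edot => z; exact: cvg_id.
    exact: (cvgr_lt _ (ce y) _ y1).
  apply: filterS => z z1.
  have rho0 : rho z != 0 by rewrite gt_eqF // divr_gt0 // subr_gt0.
  rewrite detE // (bigD1 i) //= big1 ?addr0 => [|j ji].
    rewrite hmetricE invmx_scalar mxE eqxx mulr1n -/(rho z).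
    by rewrite mulrA; congr (_ * _); rewrite -addn2 exprD mulfK // expf_neq0.
  by rewrite hmetricE invmx_scalar mxE eq_sym (negbTE ji) mulr0n mul0r.
have rho0 : rho y != 0 by rewrite gt_eqF // divr_gt0 // subr_gt0.
have y1N : 1 - edot y y != 0 by rewrite gt_eqF // subr_gt0.
have drho i : is_derive y (delta_mx ord0 i) rho (rho y ^+ 2 * y ord0 i).
  have d1 : is_derive y (delta_mx ord0 i) (fun z => 1 - edot z z)
      (- (2 * y ord0 i)).
    have d2 := is_derive_edot y (delta_mx ord0 i).
    have -> : (fun z => 1 - edot z z) = cst 1 - (fun z : 'rV[R]_m.+2 => edot z z).
      by [].
    by apply: is_derive_eq; rewrite edot_delta add0r.
  have d3 : is_derive y (delta_mx ord0 i) (fun z => (1 - edot z z)^-1)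
     (- (1 - edot y y) ^- 2 *: - (2 * y ord0 i)).
    split; first by apply: derivableV.
    by rewrite deriveV // derive_val.
  have -> : rho = 2 \*: (fun z => (1 - edot z z)^-1) by [].
  apply: is_derive_eq; rewrite /rho.
  transitivity (2 * (- (1 - edot y y) ^- 2 * - (2 * y ord0 i))); first by [].
  rewrite -[RHS]/((2 / (1 - edot y y)) ^+ 2 * y ord0 i).
  by field.
have powE (r : R) k : k%:R * r ^+ k.-1 * r ^+ 2 = k%:R * r ^+ k.+1.
  by case: k => [|k]; rewrite ?mul0r // -mulrA -exprD addn2.
have drhom i : is_derive y (delta_mx ord0 i) (fun z => rho z ^+ m)
    (m%:R * rho y ^+ m.+1 * y ord0 i).
  have d := drho i.
  have -> : (fun z => rho z ^+ m) = rho ^+ m.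
    by apply/funext => z; rewrite fctE.
  apply: is_derive_eq.
  transitivity (m%:R * rho y ^+ m.-1 * (rho y ^+ 2 * y ord0 i)); first by [].
  by rewrite mulrA powE.
have termE i : partial i (fun z => rho z ^+ m * partial i u z) y =
   rho y ^+ m * partial i (partial i u) y
   + m%:R * rho y ^+ m.+1 * (y ord0 i * partial i u y).
  have d := drhom i.
  rewrite /partial.
  have -> : (fun z => rho z ^+ m * 'D_(delta_mx ord0 i) u z) =
     (fun z => rho z ^+ m) * 'D_(delta_mx ord0 i) u by [].
  rewrite deriveM // ?derive_val; last exact: du.
  rewrite [_ *: 'D_ _ _ _]/(_ * _) /=.
  by rewrite -/(partial i u); congr (_ + _); rewrite [_ *: _]mulrC; ring.
rewrite /hlaplacian /laplace_beltrami.
under eq_bigr do rewrite fluxE termE.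
rewrite big_split /= -!mulr_sumr detE //.
have -> : (1 - edot y y) / 2 = (rho y)^-1 by rewrite /rho invf_div.
have -> : m.+2%:R - 2 = m%:R :> R by rewrite -addn2 natrD addrK.
set a := \sum_(i < _) _; set b := \sum_(i < _) _.
rewrite !exprS.
have rm0 : rho y ^+ m != 0 by rewrite expf_neq0.
by field; rewrite rho0 rm0.
Qed.

(** * The interior estimate *)

(** A minimum principle with the barrier b |y - x|^2, where b is such that the
    barrier equals 2 e on the sphere of radius d / 2 about x, with
    d = 1 - |x|.  The sum f of s u and the barrier is below c + e at x and above
    c + e on that sphere, so its minimum over the closed ball is attained at an
    interior point y0, which is in Omega because s u > 0 there.  At y0 the
    gradient of s u is minus that of the barrier and its pure second
    derivatives are at least - 2 b.  As 1 - |y0|^2 is at most of order d and b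
    is of order e / d^2, the powers of d cancel in the hyperbolic Laplacian and
    a multiple of e remains.  The factor s allows one to treat negative values
    of u. *)
Lemma eigenfunction_oscillation {R : realType} {n : nat} (Omega : set 'rV[R]_n)
    (lambda : R) (u : 'rV[R]_n -> R) (s c e : R) (x : 'rV[R]_n) :
  (2 <= n)%N -> Omega `<=` hspace R n -> open Omega -> 0 <= lambda ->
  eigenfunction Omega lambda u -> Omega x -> 0 < e -> e < c ->
  (forall y, hclosure Omega y -> enorm (y - x) <= (1 - enorm x) / 2 ->
     c - e < s * u y < c + e) ->
  lambda * (c - e) <= 48 * n%:R * e.
Proof.
move=> n2 OH Oo l0 [uc uC2 _ ueq u0] Ox e0 ec uclose.
pose d := 1 - enorm x.
have xE : enorm x = 1 - d by rewrite /d; ring.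
have d0 : 0 < d by rewrite subr_gt0; exact: OH.
(* The barrier is b (d / 2)^2 = 2 e on the sphere of radius d / 2. *)
pose b := 8 * e / d ^+ 2.
have b0 : 0 < b by rewrite divr_gt0 ?exprn_gt0 // mulr_gt0.
have bE : b * d ^+ 2 = 8 * e by rewrite /b divfK // expf_neq0 // gt_eqF.
pose K := [set y | enorm (y - x) <= d / 2] `&` closure Omega.
have KH y : K y -> hclosure Omega y.
  move=> [/= yd yO]; split => //; rewrite /hspace /=.
  rewrite -(subrK x y); apply: le_lt_trans (enorm_triangle _ _) _.
  by rewrite xE; lra.
have Kx : K x.
  split; last exact: subset_closure.
  rewrite /= subrr enorm0.
  by rewrite divr_ge0 // ltW.
have Kc : compact K.
  by apply: compact_closedI; [exact: enorm_le_compact | exact: closed_closure].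
pose f (y : 'rV[R]_n) : R := s * u y + b * edot (y - x) (y - x).
have fc : {within K, continuous f}.
  move=> y; apply: cvgD; last first.
    apply: cvgM; first exact: cvg_cst.
    apply: (@continuous_subspaceT _ _ K (fun z : 'rV[R]_n => edot (z - x) (z - x))).
    by apply: continuous_edot => z; exact: (cvgB cvg_id (cvg_cst x)).
  apply: cvgM; first exact: cvg_cst.
  exact: (continuous_subspaceW KH uc).
have [y0 /set_mem Ky fmin] := EVT_min_rV (ex_intro _ x Kx) Kc fc.
have yH := KH _ Ky.
have uy := uclose _ yH Ky.1.
have fyx : f y0 < c + e.
  apply: le_lt_trans (fmin x (mem_set Kx)) _.
  rewrite /f subrr -sqr_enorm enorm0 expr0n mulr0 addr0.
  by have /andP[] := uclose x (KH _ Kx) Kx.1.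
have yint : enorm (y0 - x) < d / 2.
  have := Ky.1; rewrite /= le_eqVlt => /orP[/eqP yd|//].
  move: fyx; rewrite /f -sqr_enorm yd.
  have -> : b * (d / 2) ^+ 2 = (b * d ^+ 2) / 4 by field.
  by rewrite bE; move/andP: uy => [h _]; lra.
have yO : Omega y0.
  apply: contrapT => yNO.
  have : hboundary Omega y0 by split => //; rewrite (interior_id _).1.
  by move/u0 => uy0; move/andP: uy => [h _]; move: h; rewrite uy0 mulr0; lra.
have nO : \forall z \near y0, Omega z by exact: open_nbhs_nbhs.
have fmin' : \forall z \near y0, f y0 <= f z.
  have nd : \forall z \near y0, enorm (z - x) < d / 2.
    exact: (cvgr_lt _ (continuous_enormB x y0) _ yint).
  near=> z; apply: fmin; apply: mem_set; split.
    by apply/ltW; near: z.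
  by apply: subset_closure; near: z.
have part i : s * partial i u y0 = - (2 * b * (y0 - x) ord0 i) /\
    - (2 * b) <= s * partial i (partial i u) y0.
  apply: local_min_partials fmin'; last by have [] := uC2 y0 yO i i.
  by apply: filterS nO => z zO; have [] := uC2 z zO i i.
have := ueq _ yO; rewrite hlaplacianE //; last first.
- by move=> i; have [] := uC2 y0 yO i i.
- exact: OH.
set q := (1 - edot y0 y0) / 2 => ly.
(* q is the inverse conformal factor at y0; it is at most of order d since
   1 - |y0| <= 3 d / 2. *)
have ny : enorm y0 < 1 := OH _ yO.
have ny0 := enorm_ge0 y0.
have nyd : 1 - 3 / 2 * d <= enorm y0.
  have := enorm_triangle y0 (- (y0 - x)).
  by rewrite enormN opprB addrC subrK xE; lra.
have q0 : 0 <= q by rewrite /q -sqr_enorm; nra.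
have qd : q <= 3 / 2 * d by rewrite /q -sqr_enorm; nra.
have ed : edot y0 (y0 - x) <= d / 2.
  apply: le_trans (edot_le_enorm _ _) _.
  have := enorm_ge0 (y0 - x); nra.
have S1 : s * \sum_(i < n) y0 ord0 i * partial i u y0
    = - (2 * b * edot y0 (y0 - x)).
  rewrite /edot !mulr_sumr -sumrN; apply: eq_bigr => i _.
  by rewrite mulrCA (part i).1; ring.
have S2 : - (2 * b * n%:R) <= s * \sum_(i < n) partial i (partial i u) y0.
  rewrite mulr_sumr.
  have -> : - (2 * b * n%:R) = \sum_(i < n) - (2 * b).
    by rewrite sumr_const card_ord mulNrn mulr_natr.
  by apply: ler_sum => i _; have [] := part i.
have sl : lambda * (s * u y0) = - (q ^+ 2 *
    (s * \sum_(i < n) partial i (partial i u) y0)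
   + (n%:R - 2) * q * (s * \sum_(i < n) y0 ord0 i * partial i u y0)).
  by rewrite mulrCA -ly; ring.
rewrite S1 in sl.
have n2R : 2 <= n%:R :> R by rewrite ler_nat.
move: sl S2; set A := s * \sum_(i < n) partial i _ _; move: A => A sl S2.
move: (edot _ _) ed sl => E ed sl.
have h1 : lambda * (c - e) <= lambda * (s * u y0).
  by rewrite ler_wpM2l //; case/andP: uy => /ltW.
apply: le_trans h1 _; rewrite sl.
have h2 : - (q ^+ 2 * A) <= q ^+ 2 * (2 * b * n%:R).
  by rewrite -mulrN ler_wpM2l ?sqr_ge0 // lerNl.
have b0' := ltW b0; have d0' := ltW d0.
have n0 : 0 <= n%:R - 2 :> R by rewrite subr_ge0.
have h3 : q ^+ 2 <= (3 / 2 * d) ^+ 2 by nra.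
have h4 : q ^+ 2 * (2 * b * n%:R) <= (3 / 2 * d) ^+ 2 * (2 * b * n%:R).
  by rewrite ler_wpM2r // mulr_ge0 // mulr_ge0.
have h5 : (n%:R - 2) * q * (2 * b * E) <= (n%:R - 2) * (3 / 2 * d) * (2 * b * (d / 2)).
  have qE : q * E <= 3 / 2 * d * (d / 2).
    have [E0|E0] := leP 0 E; first by rewrite ler_pM.
    by have : 0 <= 3 / 2 * d * (d / 2); nra.
  have -> : (n%:R - 2) * q * (2 * b * E) = (n%:R - 2) * (2 * b) * (q * E) by ring.
  rewrite [leRHS](_ : _ = (n%:R - 2) * (2 * b) * (3 / 2 * d * (d / 2))); last by ring.
  by rewrite ler_wpM2l // mulr_ge0 // mulr_ge0.
have -> : - (q ^+ 2 * A + (n%:R - 2) * q * - (2 * b * E))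
   = - (q ^+ 2 * A) + (n%:R - 2) * q * (2 * b * E) by ring.
have T : (3 / 2 * d) ^+ 2 * (2 * b * n%:R) + (n%:R - 2) * (3 / 2 * d) * (2 * b * (d / 2))
  = (9 / 2 * n%:R + 3 / 2 * (n%:R - 2)) * (b * d ^+ 2) by field.
rewrite bE in T.
have h6 : (9 / 2 * n%:R + 3 / 2 * (n%:R - 2)) * (8 * e) <= 48 * n%:R * e by nra.
by lra.
Unshelve. all: by end_near.
Qed.

(** * The cone topology near the sphere at infinity *)

Lemma hdist0E {R : realType} {n : nat} (x : 'rV[R]_n) :
  hdist 0 x = arcosh (1 + 2 * enorm x ^+ 2 / (1 - enorm x ^+ 2)).
Proof. by rewrite /hdist sub0r enormN enorm0 expr0n subr0 mul1r. Qed.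

Lemma arcosh_ge_ln {R : realType} (t : R) : 0 < t -> ln t <= arcosh t.
Proof.
move=> t0; rewrite /arcosh ler_ln ?posrE //; last by rewrite ltr_wpDr ?sqrtr_ge0.
by rewrite lerDl sqrtr_ge0.
Qed.

Lemma arcosh_le_ln {R : realType} (t T : R) :
  0 < t -> t <= T -> arcosh t <= ln (2 * T).
Proof.
move=> t0 tT; have T0 : 0 < T by rewrite (lt_le_trans t0).
have st : Num.sqrt (t ^+ 2 - 1) <= t.
  rewrite -[leRHS]ger0_norm ?(ltW t0) // -sqrtr_sqr ler_wsqrtr //.
  by rewrite lerBlDr lerDl.
rewrite /arcosh ler_ln ?posrE; [lra| |lra].
by rewrite ltr_wpDr ?sqrtr_ge0.
Qed.

Lemma hbounded_eball {R : realType} {n : nat} (r : R) :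
  r < 1 -> hbounded [set x : 'rV[R]_n | enorm x <= r].
Proof.
move=> r1; split=> [x /= /le_lt_trans|]; first exact.
exists 0, (ln (2 * (1 + 2 * r ^+ 2 / (1 - r ^+ 2)))).
split=> [|x /= xr]; first by rewrite /hspace /= enorm0.
have x0 := enorm_ge0 x.
have xr2 : enorm x ^+ 2 <= r ^+ 2 by rewrite ler_pXn2r ?nnegrE // (le_trans x0).
have r21 : r ^+ 2 < 1 by rewrite expr_lt1 // (le_trans x0).
rewrite hdist0E; apply: arcosh_le_ln.
  by rewrite ltr_wpDr // divr_ge0 ?mulr_ge0 ?sqr_ge0 // subr_ge0; lra.
rewrite lerD2l ler_pM ?mulr_ge0 ?sqr_ge0 ?invr_ge0 ?subr_ge0 //; try lra.
by rewrite lef_pV2 ?posrE ?subr_gt0; lra.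
Qed.

(** From the centre, hdist 0 x >= - ln (1 - |x|^2) up to a constant; the
    threshold m below is chosen accordingly. *)
Lemma hdist0_near_sphere {R : realType} {n : nat} (r : R) (xi : 'rV[R]_n) :
  enorm xi = 1 -> \forall x \near xi, hspace R n x -> r < hdist 0 x.
Proof.
move=> xi1; have er := expR_gt0 (- r).
pose m := Num.max (1 / 2) (1 - expR (- r) / 4).
have m1 : m < enorm xi.
  by rewrite xi1 /m gt_max; apply/andP; split; lra.
apply: filterS (cvgr_gt _ (continuous_enorm xi) _ m1) => x.
rewrite gt_max => /andP[x2 xe]; rewrite /hspace /= => x1.
have x21 : 0 < 1 - enorm x ^+ 2 by nra.
have t0 : 0 <= 2 * enorm x ^+ 2 / (1 - enorm x ^+ 2).
  by apply: divr_ge0; [rewrite mulr_ge0 ?sqr_ge0 | exact: ltW].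
have t1 : 0 < 1 + 2 * enorm x ^+ 2 / (1 - enorm x ^+ 2) by lra.
rewrite hdist0E; apply: lt_le_trans (arcosh_ge_ln _ t1).
rewrite -[ltLHS]expRK ltr_ln ?posrE ?expR_gt0 //.
apply: (@lt_trans _ _ (2 * enorm x ^+ 2 / (1 - enorm x ^+ 2))); last by lra.
rewrite ltr_pdivlMr // -[r]opprK expRN ltr_pdivrMl //.
move: (expR (- r)) er xe => e e0 xe.
have h1 : 1 - enorm x ^+ 2 < e / 2 by nra.
have h2 : 1 / 4 < enorm x ^+ 2 by nra.
by nra.
Qed.

(** The cosine of the angle is continuous away from 0 and equals 1 at xi.
    Working with the cosine avoids the continuity of acos at the endpoint 1 of
    its domain. *)
Lemma angle0_near_sphere {R : realType} {n : nat} (theta : R) (xi : 'rV[R]_n) :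
  0 < theta -> enorm xi = 1 -> \forall x \near xi, angle0 x xi < theta.
Proof.
move=> th0 xi1; have pi0 := pi_gt0 R.
pose th := Num.min theta pi.
have th_gt0 : 0 < th by rewrite lt_min th0.
have thpi : th <= pi by rewrite ge_min lexx orbT.
have thI : th \in `[0, pi] by rewrite in_itv /= thpi ltW.
have costh : cos th < 1.
  by rewrite -[ltRHS]cos0 ltr_cos // in_itv /= lexx ltW.
pose q (x : 'rV[R]_n) := edot x xi / (enorm x * enorm xi).
have qxi : q xi = 1 by rewrite /q -sqr_enorm xi1; field.
have e1 : continuous (fun x : 'rV[R]_n => edot x xi).
  apply: (@continuous_edot R n id (fun _ => xi)) => y; first exact: cvg_id.
  exact: cst_continuous.
have e2 : continuous (fun x : 'rV[R]_n => enorm x * enorm xi).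
  move=> y; exact: (cvgM (continuous_enorm y) (cvg_cst _)).
have e2xi : enorm xi * enorm xi != 0 by rewrite xi1 mulr1 oner_eq0.
have qc : q x @[x --> xi] --> q xi.
  exact: (cvgM (e1 xi) (cvgV e2xi (e2 xi))).
have q1 : cos th < q xi by rewrite qxi.
have xi0 : 0 < enorm xi by rewrite xi1.
have near_q : \forall x \near xi, cos th < q x by exact: (cvgr_gt _ qc _ q1).
have near_0 : \forall x \near xi, 0 < enorm x.
  exact: (cvgr_gt _ (continuous_enorm xi) _ xi0).
apply: filterS2 near_q near_0 => x qx x0.
have qle : q x <= 1.
  by rewrite /q ler_pdivrMr ?mul1r ?edot_le_enorm // xi1 mulr1.
have qI : -1 <= q x <= 1.
  by rewrite qle andbT; apply: le_trans (ltW qx); exact: cos_geN1.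
have -> : angle0 x xi = acos (q x) by [].
apply: (@lt_le_trans _ _ th); last by rewrite ge_min lexx.
rewrite -ltr_cos // ?acosK ?in_itv //=.
by rewrite acos_ge0 // acos_lepi.
Qed.

(** At a point of the sphere the cone topology is no finer than the Euclidean
    topology of the closed ball, so Euclidean compactness yields points of the
    asymptotic boundary, and limits in the cone topology are Euclidean limits. *)
Lemma truncated_cone_near {R : realType} {n : nat} (xi : 'rV[R]_n) (theta r : R) :
  enorm xi = 1 -> 0 < theta ->
  \forall x \near xi, hcompact R n x -> truncated_cone xi theta r x.
Proof.
move=> xi1 th0.
have near_angle := angle0_near_sphere _ _ th0 xi1.
have near_dist := hdist0_near_sphere r _ xi1.
by apply: filterS2 near_angle near_dist => x xa xd xH; split.
Qed.

(** * The value at infinity and the theorem *)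

(** The estimate [eigenfunction_oscillation] applies to c u, which is close to
    c^2 > 0 near xi, on balls of radius (1 - |x|) / 2 centred at points x of
    Omega close to xi: such balls stay close to xi. *)
Lemma boundary_value_eq0 {R : realType} {n : nat} (Omega : set 'rV[R]_n)
    (lambda : R) (u : 'rV[R]_n -> R) (xi : 'rV[R]_n) (c : R) :
  (2 <= n)%N -> Omega `<=` hspace R n -> open Omega -> 0 < lambda ->
  eigenfunction Omega lambda u ->
  enorm xi = 1 -> closure Omega xi ->
  (forall e, 0 < e -> \forall x \near xi, hclosure Omega x -> `|u x - c| < e) ->
  c = 0.
Proof.
move=> n2 OH Oo l0 eig xi1 Oxi ucvg; apply/eqP; apply: contraT => c0.
have ac : 0 < `|c| by rewrite normr_gt0.
have cc : 0 < c * c by rewrite -expr2 exprn_even_gt0.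
(* Any e with e (48 n + lambda) < lambda c^2 contradicts the estimate. *)
pose D := 48 * n%:R + 2 * lambda.
have nn : 0 <= n%:R :> R by [].
have D0 : 0 < D by rewrite /D; lra.
pose e := lambda * (c * c) / D.
have eD : e * D = lambda * (c * c) by rewrite /e divfK // gt_eqF.
have e0 : 0 < e by rewrite divr_gt0 // mulr_gt0.
have ec : e < c * c.
  by rewrite /e ltr_pdivrMr // mulrC ltr_pM2l // /D; lra.
have /nbhs_ballP[eta /= eta0 near_xi] := ucvg (e / `|c|) (divr_gt0 e0 ac).
have [x [Ox xxi]] := Oxi _ (enorm_near xi _ (divr_gt0 eta0 (ltr0Sn R 1))).
have xd : 1 - enorm x <= enorm (x - xi).
  have := enorm_triangle x (xi - x); rewrite addrC subrK xi1.
  by rewrite -[xi - x]opprB enormN; lra.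
have : lambda * (c * c - e) <= 48 * n%:R * e.
  apply: (eigenfunction_oscillation _ _ _ c _ _ _ n2 OH Oo (ltW l0) eig Ox) => //.
  move=> y Oy yx.
  have : `|u y - c| < e / `|c|.
    apply: near_xi => //; rewrite -ball_normE /=.
    apply: le_lt_trans (norm_le_enorm _) _.
    have := enorm_triangle (x - y) (xi - x).
    rewrite [x - y + _]addrC addrA subrK -(opprB y x) -(opprB x xi) !enormN.
    by move: xxi => /=; lra.
  rewrite ltr_pdivlMr // mulrC -normrM mulrBr ltr_norml.
  by move=> /andP[h1 h2]; apply/andP; split; lra.
by move: eD; rewrite /D; nra.
Qed.

Theorem proposition4p2 (R : realType) (n : nat) (Omega : set 'rV[R]_n)
    (lambda : R) (u : 'rV[R]_n -> R) :
  (2 <= n)%N ->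
  Omega `<=` hspace R n ->
  open Omega ->
  ~ hbounded Omega ->
  0 < lambda ->
  lambda <= (n%:R - 1) ^+ 2 / 4 ->
  eigenfunction Omega lambda u ->
  extends_to_infinity Omega u ->
  u x @[x --> within Omega (hinfty R n)] --> (0 : R).
Proof.
move=> n2 OH Oo _ l0 _ eig [U [Uu Uc]].
move=> B /nbhs_ballP[e /= e0 eB].
(* Bounded sets are exhausted by the Euclidean balls of radius r < 1. *)
suff [r r1 ur] : exists2 r : R, r < 1 &
    forall x, Omega x -> r < enorm x -> `|u x| < e.
  exists [set x | enorm x <= r]; first exact: hbounded_eball.
  move=> x [/= xH /negP]; rewrite -ltNge => rx Ox; apply: eB.
  by rewrite -ball_normE /= sub0r normrN; exact: ur.
apply: contrapT => noR.
pose S (r : R) := [set x | [/\ Omega x, r < enorm x & e <= `|u x|]].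
have S0 r : r < 1 -> S r !=set0.
  move=> r1; apply: contrapT => Sr; apply: noR; exists r => // x Ox rx.
  by rewrite ltNge; apply/negP => ex; apply: Sr; exists x; split.
(* The sets S r decrease to the sphere as r tends to 1, so a cluster point of
   the filter they generate lies on it. *)
pose F := filter_from [set r : R | r < 1] S.
have FF : ProperFilter F.
  apply: filter_from_proper => //; apply: filter_from_filter.
    by exists 0; rewrite /= ltr01.
  move=> r1 r2 /= r11 r21; exists (Num.max r1 r2); first by rewrite /= gt_max r11.
  by move=> x [Ox + ex]; rewrite gt_max => /andP[xr1 xr2]; split; split.
have Fball : F [set x | enorm (x - 0) <= 1].
  exists 0; first exact: ltr01.
  by move=> x [Ox _ _] /=; rewrite subr0 ltW //; exact: OH.
have [xi [/= xi_le1 xi_cl]] := enorm_le_compact 0 1 F FF Fball.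
rewrite subr0 in xi_le1.
have xi1 : enorm xi = 1.
  apply/eqP; rewrite eq_le xi_le1 leNgt; apply/negP => xi_lt1.
  pose r := (enorm xi + 1) / 2.
  have [y [[_ ry _] yr]] : S r `&` [set y | enorm y < r] !=set0.
    apply: xi_cl; first by exists r => //; rewrite /= /r; lra.
    apply: (cvgr_lt _ (continuous_enorm xi)); rewrite /r; lra.
  by move: yr => /=; rewrite ltNge ltW.
have meet P : (\forall x \near xi, P x) -> exists x, [/\ Omega x, e <= `|u x| & P x].
  move=> nP; have FS0 : F (S 0) by exists 0; first exact: ltr01.
  by have [x [[Ox _ ex] Px]] := xi_cl _ _ FS0 nP; exists x.
have xi_Ocl : closure Omega xi.
  by move=> P /meet[x [Ox _ Px]]; exists x.
have xi_inf : asymptotic_boundary Omega xi.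
  split=> //; split; first by right.
  move=> P; rewrite /cone_nbhs xi1 ltxx => -[[th r] /= [th0 r0] TP].
  have [x [Ox _ Tx]] := meet _ (truncated_cone_near xi th r xi1 th0).
  by exists x; split=> //; apply: TP; apply: Tx; left; exact: OH.
have Uxi := Uc xi (or_intror xi_inf).
have ucvg d : 0 < d -> \forall x \near xi, hclosure Omega x -> `|u x - U xi| < d.
  move=> d0; have := Uxi _ (nbhsx_ballx (U xi) d d0).
  rewrite /cone_nbhs xi1 ltxx => -[[th r] /= [th0 _] TP].
  apply: filterS (truncated_cone_near xi th r xi1 th0) => x Tx Ox.
  have := TP x (Tx (or_introl Ox.2)) (or_introl Ox).
  by rewrite -ball_normE /= distrC (Uu x).
have Uxi0 := boundary_value_eq0 _ _ _ _ _ n2 OH Oo l0 eig xi1 xi_Ocl ucvg.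
have [x [Ox ex ux]] := meet _ (ucvg e e0).
have := ux (conj (subset_closure Ox) (OH _ Ox)).
by rewrite Uxi0 subr0 ltNge ex.
Qed.
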